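(* For any $n, k, d \in \mathbb{N}$ and any $\epsilon, \delta, \gamma > 0$, there exists a (not necessarily computationally efficient) one-query $(O(\epsilon d), k\delta+\gamma)$-steward for $k$ adaptively chosen $(\epsilon,\delta)$-concentrated functions $f_1,\dots,f_k: \{0,1\}^n \to \mathbb{R}^d$ with randomness complexity \[ n + k\log(d+2) + 2\log(1/\gamma) + O(1). \]
   Context: A function $f: \{0,1\}^n \to \mathbb{R}^d$ is $(\epsilon,\delta)$-concentrated at $\mu \in \mathbb{R}^d$ if $\Pr_{X}[\|f(X) - \mu\|_\infty > \epsilon] \le \delta$ for uniform $X\in\{0,1\}^n$. An $(\epsilon', \delta')$-steward for $k$ adaptively chosen $(\epsilon,\delta)$-concentrated functions is a randomized algorithm $\mathsf{S}$ interacting with an arbitrary (possibly randomized) owner $\mathsf{O}$: for $i = 1,\dots,k$, $\mathsf{O}$ adaptively chooses $f_i$ that is $(\epsilon,\delta)$-concentrated at some $\mu_i\in\mathbb{R}^d$ and gives it to $\mathsf{S}$, which returns $Y_i \in \mathbb{R}^d$; for every $\mathsf{O}$, $\Pr[\max_i \|Y_i - \mu_i\|_\infty > \epsilon'] \le \delta'$. It is one-query if it accesses each $f_i$ only by evaluating it at a single point $X_i$ (not seen by the owner). Randomness complexity is the number of random bits used by the steward. Logarithms are base 2; $O(\cdot)$ constants are absolute.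
   Formalization: The randomness bound n + k log(d+2) + 2 log(1/γ) + O(1) is replaced by its maximum with 0, since for very large γ it is negative and no steward can use a negative number of random bits. *)

(* Defs.v *)
From HB Require Import structures.
From mathcomp Require Import all_boot all_order all_algebra.
From mathcomp Require Import all_classical all_reals all_analysis.

Set Implicit Arguments.
Unset Strict Implicit.
Unset Printing Implicit Defensive.

Import Order.TTheory GRing.Theory Num.Theory.
Import numFieldNormedType.Exports.

Local Open Scope classical_set_scope.
Local Open Scope ring_scope.

Definition log2 (R : realType) (x : R) : R := ln x / ln 2.

Definition uniform_pr (R : realType) (T : finType) (A : pred T) : R :=
  #|A|%:R / #|T|%:R.

Definition query_fun (R : realType) (n d : nat) := n.-tuple bool -> 'rV[R]_d.

(* The norm of 'rV[R]_d is the sup norm, see [mx_normrE]. *)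
Definition concentrated (R : realType) (n d : nat) (eps delta : R)
    (f : query_fun R n d) (mu : 'rV[R]_d) : Prop :=
  uniform_pr R [pred x | eps < `|f x - mu|] <= delta.

(* A steward using m random bits. [S s fs] is its reply to the last function of
   the nonempty list [fs] of all functions received so far, when its random
   bits are [s]. *)
Definition steward (R : realType) (n d m : nat) :=
  m.-tuple bool -> seq (query_fun R n d) -> 'rV[R]_d.

(* An owner whose own coins are fixed. Both fields take the list of the replies
   Y_1, ..., Y_(i-1) received so far and give f_i and mu_i; the center mu_i is
   committed to together with f_i, since concentration does not determine it. *)
Record owner (R : realType) (n d : nat) := Owner {
  next_fun : seq 'rV[R]_d -> query_fun R n d;
  next_center : seq 'rV[R]_d -> 'rV[R]_d
}.

Definition legal_owner (R : realType) (n d k : nat) (eps delta : R)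
    (O : owner R n d) : Prop :=
  forall ys, (size ys < k)%N ->
    concentrated eps delta (next_fun O ys) (next_center O ys).

Section Interaction.
Variables (R : realType) (n d m : nat) (S : steward R n d m) (O : owner R n d).
Variable s : m.-tuple bool.

Definition play_round (h : seq (query_fun R n d) * seq 'rV[R]_d) :=
  let fs := rcons h.1 (next_fun O h.2) in (fs, rcons h.2 (S s fs)).

Definition replies (i : nat) : seq 'rV[R]_d :=
  (iter i play_round ([::], [::])).2.

(* Rounds are numbered from 0: round i is played after the replies in
   [replies i], and its own reply is the item i of [replies i.+1]. *)
Definition max_error (k : nat) : R :=
  \big[Num.max/0]_(i < k)
    `|nth 0 (replies i.+1) i - next_center O (replies i)|.

End Interaction.

(* A randomized owner draws all its coins w from an arbitrary probability space.
   The steward's bits are uniform and independent of w, so that the probability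
   of failure is the average over s of the probability over w. The owners
   considered are all those for which this probability makes sense, i.e., for
   which the failure events are measurable; those with constant [O] always
   qualify. *)
Definition is_steward (R : realType) (n d m k : nat)
    (eps delta eps' delta' : R) (S : steward R n d m) : Prop :=
  forall (disp : measure_display) (T : measurableType disp)
         (P : probability T R) (O : T -> owner R n d),
    let failure s := [set w | eps' < max_error S (O w) s k] in
    (forall w, legal_owner k eps delta (O w)) ->
    (forall s, measurable (failure s)) ->
    (((2 ^- m)%:E * \sum_(s : m.-tuple bool) P (failure s))%E <= delta'%:E)%E.

(* The values f_1(X_1), ..., f_i(X_i) when the point X_j queried in f_j is
   [query] applied to f_1(X_1), ..., f_(j-1)(X_(j-1)). *)
Definition query_values (R : realType) (n d : nat)
    (query : seq 'rV[R]_d -> n.-tuple bool) (fs : seq (query_fun R n d)) :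
    seq 'rV[R]_d :=
  foldl (fun ws f => rcons ws (f (query ws))) [::] fs.

Definition one_query (R : realType) (n d m : nat) (S : steward R n d m) : Prop :=
  exists (query : m.-tuple bool -> seq 'rV[R]_d -> n.-tuple bool)
         (output : m.-tuple bool -> seq 'rV[R]_d -> 'rV[R]_d),
    forall s fs, S s fs = output s (query_values (query s) fs).

(* Main.v *)
(* The steward replies to [f_i] by rounding [f_i(X_i)] to a grid of cells of side
   [2 * eps * (d + 1)], shifted by one of [d + 1] offsets chosen so that the whole
   [eps]-ball around [f_i(X_i)] falls in one cell. As long as [f_i(X_i)] is
   [eps]-close to the center [mu_i], the reply is also the rounding of [mu_i] with
   that offset, so only [log (d + 1)] bits about [X_i] leak to the owner. Against a
   fixed owner the interaction is thus a tree of depth [k] with [d + 1] branches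
   per node, plus failure, and independent uniform points [X_i] fail with
   probability at most [k * delta]. There are few enough trees for a union bound:
   some map from [m] random bits to [X_1, ..., X_k] preserves the failure
   probability of every tree up to [gamma]. *)
Require Import Defs.
From HB Require Import structures.
From mathcomp Require Import all_boot all_order all_algebra.
From mathcomp Require Import all_classical all_reals all_analysis.
From mathcomp Require Import measurable_realfun zify ring lra.

Set Implicit Arguments.
Unset Strict Implicit.
Unset Printing Implicit Defensive.

Import Order.TTheory GRing.Theory Num.Theory.
Import numFieldNormedType.Exports.

Local Open Scope ring_scope.

(** * Existence of a good sampling map by exponential moments *)

Lemma card_pred_sum (U : finType) (A : pred U) : #|A| = (\sum_u A u)%N.
Proof.
rewrite -sum1_card big_mkcond/=; apply: eq_bigr => u _.
by rewrite unfold_in; case: (A u).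
Qed.

Lemma card_predE {R : realType} (U : finType) (A : pred U) :
  #|A|%:R = \sum_u (A u)%:R :> R.
Proof. by rewrite card_pred_sum natr_sum. Qed.

Section Sampling.
Context {R : realType}.

(** Since [expR (- y) >= 1 - y], it suffices that [(1 + y + 2 * y ^+ 2) * (1 - y)], which equals
    [1 + y ^+ 2 * (1 - 2 * y)], is at least 1. *)
Lemma expR_le_quadratic (y : R) : y <= 2^-1 -> expR y <= 1 + y + 2 * y ^+ 2.
Proof.
move=> y2; have h := expR_ge1Dx (- y).
have e0 : expR y * expR (- y) = 1 by rewrite expRxMexpNx_1.
have p : 0 < expR y := expR_gt0 y.
have yy : 0 <= y ^+ 2 := sqr_ge0 y.
have q : expR y * (1 - y) <= 1 by rewrite -[leRHS]e0 ler_wpM2l// ltW.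
have r : 1 <= (1 + y + 2 * y ^+ 2) * (1 - y).
  rewrite -subr_ge0.
  have -> : (1 + y + 2 * y ^+ 2) * (1 - y) - 1 = y ^+ 2 * (1 - 2 * y) by ring.
  by rewrite mulr_ge0//; lra.
have y1 : 0 < 1 - y by lra.
by rewrite -(ler_pM2r y1) (le_trans q).
Qed.

(** A crude Hoeffding bound: after [expR_le_quadratic] the linear terms cancel, because the
    deviations from the mean sum to 0. *)
Lemma mgf_bernoulli (U : finType) (A : pred U) (l : R) :
    0 <= l <= 2^-1 ->
  \sum_u expR (l * ((A u)%:R - uniform_pr R A)) <=
  #|U|%:R * expR (2 * l ^+ 2).
Proof.
move=> /andP[l0 l2]; set p := uniform_pr R A.
have [U0|U0] := posnP #|U|.
  rewrite big1 ?U0 ?mul0r// => u _.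
  by have := fintype0 u; rewrite U0 => /(_ erefl).
have UR : 0 < #|U|%:R :> R by rewrite ltr0n.
have p01 : 0 <= p <= 1.
  by rewrite divr_ge0//= ler_pdivrMr// mul1r ler_nat max_card.
have step u : expR (l * ((A u)%:R - p)) <=
    1 + l * ((A u)%:R - p) + 2 * l ^+ 2.
  have b01 : (0 <= (A u)%:R :> R) && ((A u)%:R <= 1 :> R).
    by case: (A u); rewrite ?lexx ?ler01.
  have le1 : l * ((A u)%:R - p) <= l by rewrite ler_piMr//; lra.
  apply: le_trans (expR_le_quadratic _) _; first by lra.
  rewrite lerD2l ler_wpM2l// exprMn ler_piMr ?sqr_ge0//.
  rewrite -[_ ^+ 2]ger0_norm ?sqr_ge0// normrX expr_le1// ler_norml.
  by apply/andP; split; lra.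
apply: (le_trans (ler_sum _ (fun u _ => step u))).
rewrite !big_split/= -mulr_sumr sumrB -card_predE !sumr_const.
rewrite -[p *+ _]mulr_natr {1}/p divfK ?gt_eqF// subrr mulr0 addr0.
rewrite -[2 * l ^+ 2 *+ _]mulr_natl -[X in X + _]mulr1 -mulrDr ler_wpM2l//.
exact: expR_ge1Dx.
Qed.

(* The exponential moments of the deviations, summed over all tests, average to
   less than 1 over the choice of [G]. *)
Lemma sampler_exists (I U T : finType) (bad : T -> pred U) (g : R) :
    0 < g <= 1 -> (0 < #|U|)%N ->
    #|T|%:R < expR (#|I|%:R * (g ^+ 2 / 8)) ->
  exists G : I -> U, forall t,
    #|[pred i | bad t (G i)]|%:R <= #|I|%:R * (uniform_pr R (bad t) + g).
Proof.
(* [g / 4] minimizes the exponent [2 * l ^+ 2 - l * g], with value [- (g ^+ 2 / 8)]. *)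
move=> /andP[g0 g1] U0 TI; pose l := g / 4; pose p t := uniform_pr R (bad t).
have l0 : 0 < l by rewrite /l; lra.
pose F t u : R := expR (l * ((bad t u)%:R - p t - g)).
pose W (G : {ffun I -> U}) : R := \sum_t \prod_i F t (G i).
have FU t : \sum_u F t u <= #|U|%:R * expR (- (g ^+ 2 / 8)).
  have -> : \sum_u F t u =
      (\sum_u expR (l * ((bad t u)%:R - p t))) * expR (- (l * g)).
    by rewrite mulr_suml; apply: eq_bigr => u _; rewrite -expRD -mulrBr.
  have ll : 0 <= l <= 2^-1 by rewrite /l; apply/andP; split; lra.
  apply: le_trans (ler_wpM2r (expR_ge0 _) (mgf_bernoulli (bad t) ll)) _.
  rewrite -mulrA -expRD ler_wpM2l// ler_expR /l; lra.
have WU : \sum_G W G < #|{ffun I -> U}|%:R.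
  rewrite exchange_big/= card_ffun natrX.
  (* The values [G i] vary independently, so the sum over [G] is a power of [\sum_u F t u]. *)
  under eq_bigr do rewrite -(bigA_distr_bigA (fun=> F _)) prodr_const.
  apply: (@le_lt_trans _ _
      (\sum_(t : T) (#|U|%:R * expR (- (g ^+ 2 / 8))) ^+ #|I|)).
    apply: ler_sum => t _; apply: lerXn2r; last exact: FU.
      by rewrite nnegrE; apply: sumr_ge0 => u _; exact: expR_ge0.
    by rewrite nnegrE mulr_ge0 ?expR_ge0.
  rewrite sumr_const exprMn -expRM_natl mulrN expRN -[_ *+ _]mulr_natr -mulrA.
  rewrite gtr_pMr ?exprn_gt0 ?ltr0n// mulrC ltr_pdivrMr ?expR_gt0//.
  by rewrite mul1r.
have [G WG] : exists G, W G < 1.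
  apply/not_existsP => WG; move: WU; rewrite -sum1_card natr_sum ltNge.
  by apply/negP/negPn/ler_sum => G _; rewrite leNgt; apply/negP/WG.
exists G => t.
have : \prod_i F t (G i) < 1.
  apply: le_lt_trans WG; rewrite /W (bigD1 t)//= lerDl.
  by apply: sumr_ge0 => t' _; apply: prodr_ge0 => i _; exact: expR_ge0.
rewrite -expR_sum -mulr_sumr expR_lt1 pmulr_rlt0// => /ltW.
rewrite (eq_bigr (fun i => (bad t (G i))%:R - (p t + g))); last first.
  by move=> i _; rewrite opprD addrA.
rewrite sumrB sumr_const subr_le0 -[(p t + g) *+ _]mulr_natl.
rewrite (card_predE [pred i | bad t (G i)]).
exact.
Qed.

End Sampling.

(** * Shifted grids and the choice of a shift *)

Section Rounding.
Context {R : realType}.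

Lemma row_norm_le (d : nat) (v : 'rV[R]_d) (c : R) :
  0 <= c -> (`|v| <= c) = [forall j, `|v ord0 j| <= c].
Proof.
move=> c0; rewrite [`|v|]mx_normrE; apply/idP/forallP => [h j|h].
  by apply: le_trans h; exact: (le_bigmax _ (fun ij => `|v ij.1 ij.2|) (ord0, j)).
apply/bigmax_leP; split => // -[i j] _ /=; rewrite ord1; exact: h.
Qed.

(** Lengths are in units of [2 * eps], so an [eps]-ball has radius 1/2; the cell boundaries are the
    integers congruent to [a] modulo [D]. *)
Definition shift_floor (D a : nat) (u : R) : R :=
  a%:R + D%:R * (Num.floor ((u - a%:R) / D%:R))%:~R.

Lemma shift_floor_itv (D a : nat) (u : R) : (0 < D)%N ->
  shift_floor D a u <= u < shift_floor D a u + D%:R.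
Proof.
move=> D0; have DR : 0 < D%:R :> R by rewrite ltr0n.
have /andP[h1 h2] := floor_itv ((u - a%:R) / D%:R).
rewrite /shift_floor; set z := (Num.floor _)%:~R in h1 h2 *.
move: h1 h2; rewrite ler_pdivlMr// ltr_pdivrMr// intrD -/z.
by rewrite mulrDl mul1r [z * _]mulrC => h1 h2; apply/andP; split; lra.
Qed.

(** A cell boundary separating [u] from [v] would lie within 1/2 of [u], hence be the integer
    [Num.floor (u + 2^-1)], whose residue is excluded. *)
Lemma shift_floor_eq (D a : nat) (u v : R) : (0 < D)%N -> `|u - v| <= 2^-1 ->
    (Num.floor (u + 2^-1) != a %[mod D])%Z ->
  shift_floor D a u = shift_floor D a v.
Proof.
move=> D0; have DR : 0 < D%:R :> R by rewrite ltr0n.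
rewrite ler_norml => /andP[uv vu] nq.
set zu := Num.floor ((u - a%:R) / D%:R); set zv := Num.floor ((v - a%:R) / D%:R).
have floor_neq (z : int) :
    ~ (a%:R + D%:R * z%:~R - 2^-1 <= u < a%:R + D%:R * z%:~R + 2^-1).
  move=> h; case/negP: nq; rewrite (@floor_def _ _ (a%:Z + D%:Z * z)).
    by rewrite mulrC addrC modzMDl.
  by rewrite !intrD intrM /=; move: h => /andP[h1 h2]; apply/andP; split; lra.
have hu := shift_floor_itv a u D0; have hv := shift_floor_itv a v D0.
rewrite /shift_floor -/zu -/zv in hu hv *.
have [zz|zz|->//] := ltgtP zu zv.
  have : D%:R * (zu%:~R + 1) <= D%:R * zv%:~R :> R.
    by rewrite ler_pM2l// -[1]/(1%:~R) -intrD ler_int lezD1.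
  by rewrite mulrDr mulr1 => h; case: (floor_neq zv); apply/andP; split; lra.
have : D%:R * (zv%:~R + 1) <= D%:R * zu%:~R :> R.
  by rewrite ler_pM2l// -[1]/(1%:~R) -intrD ler_int lezD1.
by rewrite mulrDr mulr1 => h; case: (floor_neq zu); apply/andP; split; lra.
Qed.

Definition good_shift (d : nat) (q : 'I_d -> int) : 'I_d.+1 :=
  odflt ord0 [pick a : 'I_d.+1 | [forall j, (q j != a %[mod d.+1])%Z]].

(** Pigeonhole: [d] integers cannot cover all [d.+1] residues. So the default [ord0] of [good_shift]
    is never reached. *)
Lemma good_shiftP (d : nat) (q : 'I_d -> int) (j : 'I_d) :
  (q j != good_shift q %[mod d.+1])%Z.
Proof.
rewrite /good_shift; case: pickP => [a /forallP//|no] /=.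
pose f (j : 'I_d) : 'I_d.+1 := inord `|(q j %% d.+1)%Z|.
suff : (#|'I_d.+1| <= #|'I_d|)%N by rewrite !card_ord ltnn.
apply: leq_trans (leq_image_card f _); apply/subset_leq_card/fintype.subsetP.
move=> a _; have /forallPn[i /negPn/eqP qa] := negbT (no a).
apply/codomP; exists i; apply: val_inj.
by rewrite /= inordK qa modz_nat ?absz_nat/= ?modn_small ?ltn_ord.
Qed.

(* The grid of cells of side [2 * eps * d.+1], shifted by [2 * eps * a]. *)
Definition round_row (d : nat) (eps : R) (a : 'I_d.+1) (w : 'rV[R]_d) : 'rV[R]_d :=
  \row_j (2 * eps * shift_floor d.+1 a (w ord0 j / (2 * eps))).

(* Each coordinate forbids only one of the [d.+1] shifts. *)
Definition row_shift (d : nat) (eps : R) (w : 'rV[R]_d) : 'I_d.+1 :=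
  good_shift (fun j => Num.floor (w ord0 j / (2 * eps) + 2^-1)).

Lemma round_row_shift (d : nat) (eps : R) (w mu : 'rV[R]_d) :
    0 < eps -> `|w - mu| <= eps ->
  round_row eps (row_shift eps w) w = round_row eps (row_shift eps w) mu.
Proof.
move=> e0; rewrite row_norm_le ?ltW// => /forallP wmu.
apply/rowP => j; rewrite !mxE; congr (_ * _).
apply: shift_floor_eq => //; last exact: good_shiftP.
rewrite -mulrBl normrM normfV [X in _ / X]gtr0_norm; last by lra.
rewrite ler_pdivrMr; last by lra.
by move: (wmu j); rewrite !mxE mulrA mulVf ?mul1r ?pnatr_eq0.
Qed.

Lemma round_row_close (d : nat) (eps : R) (a : 'I_d.+1) (mu : 'rV[R]_d) :
  0 < eps -> `|round_row eps a mu - mu| <= 2 * eps * d.+1%:R.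
Proof.
move=> e0; rewrite row_norm_le ?mulr_ge0//; last by lra.
apply/forallP => j; rewrite !mxE.
have /andP[] := shift_floor_itv a (mu ord0 j / (2 * eps)) (ltn0Sn d).
set s := shift_floor _ _ _; have e2 : 0 < 2 * eps by lra.
rewrite ler_pdivlMr// ltr_pdivrMr// [(s + _) * _]mulrDl => h1 h2.
rewrite ler_norml [_ * s]mulrC [_ * d.+1%:R]mulrC.
by apply/andP; split; lra.
Qed.

End Rounding.

(** * Decision trees and their number *)

Section Trees.
Variables (X A : finType).

(* A node maps the queried point to a branch, or to [None] for failure. *)
Fixpoint tree (k : nat) : finType :=
  if k is k'.+1 then ({ffun X -> option A} * {ffun A -> tree k'})%type else unit.

(** The value [false] on an exhausted list is a default: the lists used are at least as long as the
    tree is deep. *)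
Fixpoint fails (k : nat) : tree k -> seq X -> bool :=
  match k with
  | 0 => fun _ _ => false
  | k'.+1 => fun (t : {ffun X -> option A} * {ffun A -> tree k'}) xs =>
      if xs is x :: xs' then
        if t.1 x is Some a then fails (t.2 a) xs' else true
      else false
  end.

(** The number of internal nodes of the complete tree; each carries one of [#|A|.+1 ^ #|X|]
    functions, whence [card_tree]. *)
Fixpoint tree_size (k : nat) : nat :=
  if k is k'.+1 then (1 + #|A| * tree_size k')%N else 0%N.

Lemma card_tree k : #|tree k| = (#|A|.+1 ^ (#|X| * tree_size k))%N.
Proof.
elim: k => [|k IH] /=; first by rewrite muln0 card_unit.
rewrite card_prod !card_ffun card_option IH -expnM -expnD.
by rewrite mulnDr muln1 -mulnA [(tree_size k * _)%N]mulnC.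
Qed.

Lemma card_fails_cons k (t : tree k.+1) :
  (#|[pred xs : k.+1.-tuple X | fails t xs]| =
   \sum_x #|[pred xs : k.-tuple X | fails t (x :: xs)]|)%N.
Proof.
rewrite card_pred_sum; under [RHS]eq_bigr do rewrite card_pred_sum.
rewrite pair_big/=.
rewrite (reindex (fun p : X * k.-tuple X => cons_tuple p.1 p.2)) //=.
exists (fun v : k.+1.-tuple X => (thead v, behead_tuple v)) => [[x v]|v] _ /=.
  by rewrite theadE; congr (_, _); apply: val_inj.
by rewrite [RHS]tuple_eta; apply: val_inj.
Qed.

End Trees.

(** * The tree of a fixed owner under independent uniform points *)

Section OwnerTree.
Context {R : realType} (n d : nat) (eps delta : R).
Variables (choose : 'rV[R]_d -> 'I_d.+1) (rnd : 'I_d.+1 -> 'rV[R]_d -> 'rV[R]_d).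

(* Failing when the queried value is far from the center makes the history [ys]
   of replies depend on the queried points only through the shifts. *)
Fixpoint owner_tree (O : owner R n d) (k : nat) (ys : seq 'rV[R]_d) :
    tree (n.-tuple bool) 'I_d.+1 k :=
  match k with
  | 0 => tt
  | k'.+1 =>
      ([ffun x => if eps < `|next_fun O ys x - next_center O ys| then None
                  else Some (choose (next_fun O ys x))],
       [ffun a => owner_tree O k' (rcons ys (rnd a (next_center O ys)))])
  end.

(** A union bound, round by round: the root fails on a fraction at most [delta] of the points, and
    every child is the tree of the same owner with a longer history. *)
Lemma card_fails_owner (O : owner R n d) (K k : nat) (ys : seq 'rV[R]_d) :
    0 < delta -> legal_owner K eps delta O -> (size ys + k <= K)%N ->
  #|[pred xs : k.-tuple (n.-tuple bool) | fails (owner_tree O k ys) xs]|%:R <=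
  k%:R * delta * #|{: k.-tuple (n.-tuple bool)}|%:R.
Proof.
move=> d0 legal; elim: k ys => [|k IH] ys size_ys.
  by rewrite !mul0r lern0; apply/eqP/eq_card0 => xs; rewrite inE.
rewrite card_fails_cons natr_sum.
set f := next_fun O ys; set mu := next_center O ys.
have size_lt : (size ys < K)%N.
  by rewrite (leq_trans _ size_ys)// addnS ltnS leq_addr.
have bad := legal ys size_lt.
(* A failing [x] is charged with all its continuations; the induction bound is granted to every
   [x]. *)
apply: (@le_trans _ _ (\sum_(x : n.-tuple bool)
   ((eps < `|f x - mu|)%R%:R * #|{: k.-tuple (n.-tuple bool)}|%:R +
    k%:R * delta * #|{: k.-tuple (n.-tuple bool)}|%:R))).
  apply: ler_sum => x _ /=; rewrite ffunE -/f -/mu; case: ifP => _.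
    by rewrite mul1r ler_wpDr ?mulr_ge0 ?(ltW d0) ?ler_nat ?max_card.
  rewrite mul0r add0r ffunE.
  by apply: IH; rewrite size_rcons addSnnS.
rewrite big_split/= -mulr_suml sumr_const -(card_predE [pred x | eps < `|f x - mu|]).
move: bad; rewrite /concentrated /uniform_pr -/f -/mu.
have N0 : 0 < #|{: n.-tuple bool}|%:R :> R.
  by rewrite ltr0n card_tuple expn_gt0 card_bool.
rewrite ler_pdivrMr// => bad.
have -> : #|{: k.+1.-tuple (n.-tuple bool)}|%:R =
    #|{: n.-tuple bool}|%:R * #|{: k.-tuple (n.-tuple bool)}|%:R :> R.
  by rewrite [in LHS]card_tuple expnS natrM -[in LHS]card_tuple.
rewrite -natr1 mulrDl mul1r mulrDl addrC -[X in X + _]mulr_natl.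
rewrite lerD//; first by rewrite mulrCA.
by rewrite mulrA ler_wpM2r.
Qed.

End OwnerTree.

(** * From fixed owners to randomized ones *)

Lemma sum_probability_le {R : realType} (disp : measure_display)
    (T : measurableType disp) (P : probability T R) (I : finType)
    (F : I -> set T) (c : R) :
    (forall i, measurable (F i)) ->
    (forall w, \sum_i \1_(F i) w <= c) ->
  (\sum_i P (F i) <= c%:E)%E.
Proof.
move=> mF Fc.
under eq_bigr do rewrite -[F _]setIT -integral_indic//.
have mI i : measurable_fun [set: T] (EFin \o (\1_(F i) : T -> R)).
  by apply/measurable_EFinP; exact: measurable_indic.
rewrite -(ge0_integral_sum P measurableT mI); last first.
  by move=> i w _; rewrite lee_fin.
apply: (@le_trans _ _ (\int[P]_(x in [set: T]) c%:E)%E).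
  apply: ge0_le_integral => //.
  - by move=> w _; apply: sume_ge0 => i _; rewrite lee_fin.
  - apply: emeasurable_sum => i; exact: mI.
  - by move=> w _; rewrite sumEFin lee_fin.
rewrite (integral_cst P measurableT c%:E) -[leRHS]mule1.
by rewrite -[in leRHS](probability_setT P).
Qed.

(** The bound on the number of failing seeds holds for each value [w] of the owner's coins; it
    survives integration over [w], which commutes with the sum over seeds. *)
Lemma deterministic_steward (R : realType) (n d m k : nat)
    (eps delta eps' delta' : R) (S : steward R n d m) :
    (forall O : owner R n d, legal_owner k eps delta O ->
     #|[pred s | eps' < max_error S O s k]|%:R <= 2 ^+ m * delta') ->
  is_steward k eps delta eps' delta' S.
Proof.
move=> det disp T P O failure legal mf.
have m0 : 0 < 2 ^+ m :> R by rewrite exprn_gt0.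
have -> : delta'%:E = ((2 ^- m)%:E * (2 ^+ m * delta')%:E)%E.
  by rewrite -EFinM mulKf// gt_eqF.
rewrite lee_pmul2l// ?lte_fin ?invr_gt0//.
apply: sum_probability_le => // w.
apply: le_trans (det (O w) (legal w)).
rewrite card_predE ler_sum// => s _; rewrite indicE/=.
by rewrite ler_nat; case: (boolP (w \in failure s)) => //= /set_mem ->.
Qed.

(** * The rounding steward against a fixed owner *)

Section Steward.
Context {R : realType} (n d m k : nat) (eps : R).
Variable G : m.-tuple bool -> k.-tuple (n.-tuple bool).

(** The points are fixed in advance by [G]; earlier values serve only to count the rounds. *)
Definition query (s : m.-tuple bool) (ws : seq 'rV[R]_d) : n.-tuple bool :=
  nth [tuple of nseq n false] (G s) (size ws).

Definition reply (w : 'rV[R]_d) : 'rV[R]_d := round_row eps (row_shift eps w) w.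

Definition rounding_steward : steward R n d m :=
  fun s fs => reply (last 0 (query_values (query s) fs)).

Lemma rounding_steward_one_query : one_query rounding_steward.
Proof. by exists query, (fun _ ws => reply (last 0 ws)). Qed.

Lemma size_query_values (q : seq 'rV[R]_d -> n.-tuple bool)
    (fs : seq (query_fun R n d)) :
  size (query_values q fs) = size fs.
Proof.
elim/last_ind: fs => // fs f IH.
by rewrite /query_values -cats1 foldl_cat/= size_rcons IH size_cat addn1.
Qed.

Lemma rounding_steward_rcons s (fs : seq (query_fun R n d)) f :
  rounding_steward s (rcons fs f) =
  reply (f (nth [tuple of nseq n false] (G s) (size fs))).
Proof.
rewrite /rounding_steward /query_values -cats1 foldl_cat/= last_rcons.
by rewrite /query -/(query_values _ _) size_query_values.
Qed.

(** As long as no node fails, each reply is the rounded center, so the real history is the one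
    stored along the path in [owner_tree]. The state [h] is arbitrary because the induction plays
    the first round and descends to a child of the root. *)
Lemma play_from_close (O : owner R n d) (s : m.-tuple bool) (j i : nat)
    (h : seq (query_fun R n d) * seq 'rV[R]_d) :
    0 < eps -> size h.1 = size h.2 -> (size h.1 + j <= k)%N ->
    ~~ fails (owner_tree eps (row_shift eps) (round_row eps) O j h.2)
         (drop (size h.1) (G s)) ->
    (i < j)%N ->
  `|last 0 (iter i.+1 (play_round rounding_steward O s) h).2 -
    next_center O (iter i (play_round rounding_steward O s) h).2| <=
  2 * eps * d.+1%:R.
Proof.
move=> e0; elim: j i h => [//|j IH i h hh hj ok ij].
have hk : (size h.1 < size (G s))%N.
  by rewrite size_tuple (leq_trans _ hj)// addnS ltnS leq_addr.
move: ok; rewrite (drop_nth [tuple of nseq n false] hk)/=.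
rewrite ffunE; case: ifP => // /negbT; rewrite -leNgt => close; rewrite ffunE.
have reply_center :
    rounding_steward s (rcons h.1 (next_fun O h.2)) =
    round_row eps
      (row_shift eps
        (next_fun O h.2 (nth [tuple of nseq n false] (G s) (size h.1))))
      (next_center O h.2).
  by rewrite rounding_steward_rcons; exact: round_row_shift.
rewrite -reply_center => ok.
case: i ij => [_|i ij].
  by rewrite /= last_rcons reply_center round_row_close.
rewrite !iterSr.
by apply: IH; rewrite //= !size_rcons -?hh ?addSnnS.
Qed.

Lemma size_replies (O : owner R n d) (s : m.-tuple bool) i :
  size (replies rounding_steward O s i) = i.
Proof. by rewrite /replies; elim: i => //= i IH; rewrite size_rcons IH. Qed.

Lemma max_error_fails (O : owner R n d) (s : m.-tuple bool) :
    0 < eps -> 2 * eps * d.+1%:R < max_error rounding_steward O s k ->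
  fails (owner_tree eps (row_shift eps) (round_row eps) O k [::]) (G s).
Proof.
move=> e0; apply: contraTT => ok; rewrite -leNgt.
apply/bigmax_leP; split; first by rewrite mulr_ge0// mulr_ge0 ?ltW.
move=> i _; have := @play_from_close O s k i ([::], [::]) e0 erefl (leqnn _).
rewrite /= drop0 => /(_ ok (ltn_ord i)).
by rewrite /replies /= nth_rcons size_replies ltnn eqxx last_rcons.
Qed.

End Steward.

(** * Trivial cases, numerical bounds and conclusion *)

Definition silent_steward (R : realType) (n d : nat) : steward R n d 0 :=
  fun _ _ => 0.

Lemma silent_steward_one_query (R : realType) (n d : nat) :
  one_query (@silent_steward R n d).
Proof. by exists (fun _ _ => [tuple of nseq n false]), (fun _ _ => 0). Qed.

Lemma tree_sizeE (A : finType) (d k : nat) : #|A| = d.+1 ->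
  (d * tree_size A k + 1 = d.+1 ^ k)%N.
Proof.
move=> cA; elim: k => [|k IH]; first by rewrite muln0.
rewrite /= cA expnS -IH; ring.
Qed.

(** Here [d.+1] is the dimension. The geometric series bounds the number of nodes by
    [d.+2 ^ k / d.+1], and the denominator absorbs [ln d.+3 <= 2 * d.+1], where [d.+3] counts the
    branches and failure. *)
Lemma card_tree_le (R : realType) (X A : finType) (d k : nat) :
    #|A| = d.+2 ->
  #|tree X A k|%:R <= expR (2 * #|X|%:R * d.+3%:R ^+ k) :> R.
Proof.
move=> cA; rewrite card_tree cA natrX -[X in X ^+ _]lnK ?posrE//.
rewrite -expRM_natl ler_expR natrM -mulrA [leRHS]mulrAC -[leRHS]mulrC ler_wpM2l//.
have size_k : d.+1%:R * (tree_size A k)%:R <= d.+3%:R ^+ k :> R.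
  rewrite -natrM -natrX ler_nat (@leq_trans (d.+2 ^ k)%N)//.
    by rewrite -(tree_sizeE k cA) leq_addr.
  by case: k => // k; rewrite leq_exp2r.
have ln_le : ln d.+3%:R <= 2 * d.+1%:R :> R.
  rewrite -[d.+3]addn1 natrD addrC (le_trans (le_ln1Dx _))//.
    by rewrite (lt_le_trans _ (ler0n _ _))// oppr_lt0.
  by rewrite -natrM ler_nat mul2n -addnn addnS ltnS; lia.
apply: le_trans (_ : 2 * (d.+1%:R * (tree_size A k)%:R) <= _).
  by rewrite mulrA mulrC ler_wpM2r.
by rewrite ler_wpM2l.
Qed.

(** The factor 16 combines the 2 of [card_tree_le] with the 8 of [sampler_exists]. It costs 4 bits,
    and rounding up to an integer costs one more. *)
Lemma seed_length (R : realType) (n k d : nat) (gamma : R) :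
    0 < gamma < 1 ->
  exists2 m : nat,
    m%:R <= n%:R + k%:R * log2 (d%:R + 2) + 2 * log2 gamma^-1 + 5 &
    16 * 2 ^+ n * (d%:R + 2) ^+ k < 2 ^+ m * gamma ^+ 2.
Proof.
move=> /andP[g0 g1].
have l2 : 0 < ln 2 :> R by rewrite ln_gt0// ltr1n.
have d2 : 0 < d%:R + 2 :> R by rewrite -natrD ltr0n addn2.
have lg : ln gamma < 0 by rewrite ln_lt0// g0.
have ld : 0 <= ln (d%:R + 2) :> R by rewrite ln_ge0// -natrD ler1n addn2.
pose x := n%:R + k%:R * log2 (d%:R + 2) + 2 * log2 gamma^-1 + 4 : R.
have x0 : 0 <= x.
  have log_ge0 (u : R) : 0 <= ln u -> 0 <= log2 u.
    by move=> u0; rewrite /log2 divr_ge0// ltW.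
  have lV : 0 <= log2 gamma^-1 by apply: log_ge0; rewrite lnV ?posrE//; lra.
  by rewrite /x !addr_ge0// mulr_ge0// log_ge0.
have /andP[mx xm] := truncn_itv x0.
exists (Num.trunc x).+1.
  by move: mx; rewrite -natr1 /x; lra.
rewrite -ltr_ln ?posrE ?mulr_gt0 ?exprn_gt0//.
rewrite !lnM ?posrE ?mulr_gt0 ?exprn_gt0// !lnXn//.
have -> : ln 16 = 4 * ln 2 :> R.
  by rewrite (_ : 16 = 2 ^+ 4) ?lnXn// ?mulr_natl//; ring.
move: xm; rewrite -(ltr_pM2r l2) /x /log2 lnV ?posrE//.
rewrite !mulrDl -!mulrA !mulVf ?gt_eqF// -!(mulr_natl (ln _)); lra.
Qed.

(* The number of bits is truncated at 0: for gamma > 1 the bound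
   n + k log (d + 2) + 2 log (1 / gamma) + O(1) may be negative. *)
Theorem theorem5p1 (R : realType) :
  exists C1 C2 : R, forall (n k d : nat) (eps delta gamma : R),
    0 < eps -> 0 < delta -> 0 < gamma ->
    exists (m : nat) (S : steward R n d m),
      [/\ one_query S,
          is_steward k eps delta (C1 * eps * d%:R) (k%:R * delta + gamma) S &
          m%:R <= Num.max 0 (n%:R + k%:R * log2 (d%:R + 2)
                             + 2 * log2 gamma^-1 + C2)].
Proof.
(* The side [2 * eps * (d + 1)] of a cell is at most [4 * eps * d] once [0 < d]; 5 comes from
   [seed_length]. *)
exists 4, 5 => n k d eps delta gamma e0 d0 g0.
have [g1|g1] := leP 1 gamma.
  exists 0%N, (@silent_steward R n d); split.
  - exact: silent_steward_one_query.
  - apply: deterministic_steward => O _; rewrite expr0 mul1r.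
    apply: le_trans (_ : 1 <= _); last by rewrite ler_wpDl// mulr_ge0// ltW.
    by rewrite lern1 (leq_trans (max_card _))// card_tuple.
  - by rewrite le_max lexx.
(* In dimension 0 the allowed error is 0, less than the side of a cell, but all rows are equal. *)
case: d => [|d].
  exists 0%N, (@silent_steward R n 0); split.
  - exact: silent_steward_one_query.
  - apply: deterministic_steward => O _.
    rewrite eq_card0 ?expr0 ?mul1r ?addr_ge0 ?mulr_ge0 ?(ltW g0) ?(ltW d0)// => s.
    rewrite inE mulr0; apply/negbTE; rewrite -leNgt; apply/bigmax_leP.
    by split=> // i _; rewrite thinmx0 normr0.
  - by rewrite le_max lexx.
have g01 : 0 < gamma < 1 by rewrite g0.
have [m m_le m_gt] := seed_length n k d.+1 g01.
(* A union bound needs finitely many tests, so [G] must handle all trees rather than all owners. *)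
have [G GP] : exists G : m.-tuple bool -> k.-tuple (n.-tuple bool),
    forall t : tree (n.-tuple bool) 'I_d.+2 k,
    #|[pred s | [pred xs : k.-tuple (n.-tuple bool) | fails t xs] (G s)]|%:R <=
    #|{: m.-tuple bool}|%:R *
      (uniform_pr R [pred xs : k.-tuple (n.-tuple bool) | fails t xs] + gamma).
  apply: sampler_exists; first by rewrite g0 ltW.
    by rewrite card_tuple expn_gt0 card_tuple expn_gt0 card_bool.
  apply: le_lt_trans (card_tree_le R _ k (card_ord d.+2)) _.
  rewrite ltr_expR !card_tuple card_bool !natrX.
  by move: m_gt; rewrite -natrD addn2; lra.
exists m, (rounding_steward eps G); split.
- exact: rounding_steward_one_query.
- apply: deterministic_steward => O legal.
  have legalP : uniform_pr R
      [pred xs : k.-tuple (n.-tuple bool) |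
        fails (owner_tree eps (row_shift eps) (round_row eps) O k [::]) xs]
      <= k%:R * delta.
    rewrite /uniform_pr ler_pdivrMr; last first.
      by rewrite ltr0n card_tuple expn_gt0 card_tuple expn_gt0 card_bool.
    exact: card_fails_owner legal _.
  apply: le_trans (_ : #|{: m.-tuple bool}|%:R * (k%:R * delta + gamma) <= _);
    last first.
    by rewrite card_tuple card_bool natrX.
  apply: le_trans (ler_wpM2l (ler0n _ _) (lerD legalP (lexx gamma))).
  apply: le_trans (GP _); rewrite ler_nat; apply/subset_leq_card/fintype.subsetP.
  move=> s; rewrite !inE => err; apply: max_error_fails => //.
  apply: le_lt_trans err; rewrite -(natr1 d.+1).
  have : 1 <= d.+1%:R :> R by rewrite ler1n.
  by rewrite mulrDr mulr1 => d1; nra.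
- by rewrite le_max m_le orbT.
Qed.
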